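(* Let $f$ be a real-valued functional of binary trees and let $F(T):=\sum_{v\in T}f(T(v))$. Assume that $$\sum_{k=1}^\infty\frac{(\mathrm{Var} f(\mathcal{T}_k))^{1/2}}{k^{3/2}}<\infty,\qquad \lim_{k\to\infty}\frac{\mathrm{Var} f(\mathcal{T}_k)}{k}=0,\qquad \sum_{k=1}^\infty\frac{(\mathbb{E} f(\mathcal{T}_k))^2}{k^2}<\infty,$$ and let $\sigma_F^2:=\lim_{n\to\infty}\mathrm{Var}(F(\mathcal{T}_n))/n$. Suppose in addition that $f(T)=f(|T|,|T_L|,|T_R|)$ depends only on the sizes of $T$ and of its left and right subtrees. Let $\nu_k:=\mathbb{E} F(\mathcal{T}_k)$, let $I_k$ be uniformly distributed on $\{0,\dots,k-1\}$, and let $$\psi_k:=\mathrm{Var}\bigl(\nu_{I_k}+\nu_{k-1-I_k}+f(k,I_k,k-1-I_k)\bigr)=\mathbb{E}\bigl(\nu_{I_k}+\nu_{k-1-I_k}+f(k,I_k,k-1-I_k)-\nu_k\bigr)^2.$$ Then $$\sigma_F^2=\sum_{k=1}^\infty\frac{2}{(k+1)(k+2)}\psi_k<\infty.$$ Moreover, $\sigma_F^2>0$ unless $\mathrm{Var} F(\mathcal{T}_n)=0$ for every $n\ge1$; this happens if and only if $f(n,k,n-1-k)=a_n-a_k-a_{n-1-k}$ (for all $n\ge1$ and $0\le k\le n-1$) for some real numbers $a_n$, $n\ge0$.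
   Context: Random binary search tree $\mathcal{T}_n$: insert the keys of a uniformly random permutation of $\{1,\dots,n\}$ one by one; the first key is placed at the root, and each later key starts at the root and at each occupied node proceeds to the left child position if it is smaller than the key there and to the right child position if it is larger, until it reaches an empty position, where it is placed. It is regarded as an unlabelled binary tree (left and right children distinguished). $|T|$ is the number of nodes of $T$. $T(v)$ is the fringe subtree of $T$ rooted at $v$ ($v$ together with all its descendants). $T_L$ and $T_R$ are the subtrees rooted at the left and right child of the root (possibly the empty tree $\emptyset$). Conventions: $\mathcal{T}_0=\emptyset$ and $F(\emptyset)=0$, so $\nu_0=0$. Under the three displayed assumptions on $f$ the limit $\sigma_F^2$ exists and is finite; in the paper $\sigma_F^2$ is equivalently defined as $\lim_{N\to\infty}\sum_{|T|,|T'|\le N}f(T)f(T')\sigma_{T,T'}$, where $\sigma_{T,T'}$ is $\mathrm{Cov}(X_n^T,X_n^{T'})/(n+1)$ (constant for $n>|T|+|T'|+1$) and $X_n^T$ is the number of fringe subtrees of $\mathcal{T}_n$ isomorphic to $T$. *)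

(* Defs.v *)
From mathcomp Require Import all_boot all_order all_algebra.
From mathcomp Require Import all_fingroup.
From mathcomp Require Import all_classical all_reals all_analysis.

Set Implicit Arguments.
Unset Strict Implicit.
Unset Printing Implicit Defensive.

Import Order.TTheory GRing.Theory Num.Theory.
Import numFieldNormedType.Exports.

Local Open Scope classical_set_scope.
Local Open Scope ring_scope.

Inductive bintree : Type :=
| Bt_empty
| Bt_node of bintree & bintree.

Fixpoint bt_size (T : bintree) : nat :=
  if T is Bt_node l r then (bt_size l + bt_size r).+1 else 0%N.

(* A node is identified with its path from the root:
   false = go to the left child, true = go to the right child. *)
Fixpoint bt_nodes (T : bintree) : seq (seq bool) :=
  if T is Bt_node l r then
    [::] :: map (cons false) (bt_nodes l) ++ map (cons true) (bt_nodes r)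
  else [::].

(* The value Bt_empty is returned when v is not a node of T. *)
Fixpoint bt_fringe (T : bintree) (v : seq bool) : bintree :=
  match v, T with
  | [::], _ => T
  | b :: v', Bt_node l r => bt_fringe (if b then r else l) v'
  | _ :: _, Bt_empty => Bt_empty
  end.

Definition additive_functional (R : realType) (f : bintree -> R)
  (T : bintree) : R := \sum_(v <- bt_nodes T) f (bt_fringe T v).

Inductive keyed_tree : Type :=
| Kt_empty
| Kt_node of keyed_tree & nat & keyed_tree.

Fixpoint kt_insert (t : keyed_tree) (x : nat) : keyed_tree :=
  if t is Kt_node l y r then
    if (x < y)%N then Kt_node (kt_insert l x) y r else Kt_node l y (kt_insert r x)
  else Kt_node Kt_empty x Kt_empty.

Fixpoint kt_shape (t : keyed_tree) : bintree :=
  if t is Kt_node l _ r then Bt_node (kt_shape l) (kt_shape r) else Bt_empty.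

(* The keys s(0)+1, ..., s(n-1)+1 are the values of a permutation of
   {1, ..., n}, inserted in this order. *)
Definition bst (n : nat) (s : 'S_n) : bintree :=
  kt_shape (foldl kt_insert Kt_empty [seq (s i).+1 | i <- enum 'I_n]).

(* Expectation and variance of X under the uniform distribution on the
   finite type Omega; meaningful when Omega is inhabited. *)
Definition unif_expect (R : realType) (Omega : finType) (X : Omega -> R) : R :=
  (\sum_w X w) / #|Omega|%:R.

Definition unif_var (R : realType) (Omega : finType) (X : Omega -> R) : R :=
  unif_expect (fun w => (X w - unif_expect X) ^+ 2).

(* The random binary search tree with n nodes is bst on the uniform
   probability space 'S_n. *)
Definition bst_expect (R : realType) (n : nat) (h : bintree -> R) : R :=
  unif_expect (fun s : 'S_n => h (bst s)).

Definition bst_var (R : realType) (n : nat) (h : bintree -> R) : R :=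
  unif_var (fun s : 'S_n => h (bst s)).

Definition sigma2F (R : realType) (f : bintree -> R) : R :=
  limn (fun n : nat => bst_var n (additive_functional f) / n%:R).

Definition nuF (R : realType) (f : bintree -> R) (k : nat) : R :=
  bst_expect k (additive_functional f).

Definition root_split (R : realType) (f : bintree -> R)
  (g : nat -> nat -> nat -> R) (k : nat) (i : 'I_k) : R :=
  nuF f i + nuF f (k - 1 - i)%N + g k i (k - 1 - i)%N.

Definition psiF (R : realType) (f : bintree -> R)
  (g : nat -> nat -> nat -> R) (k : nat) : R :=
  unif_var (@root_split R f g k).

(* Main.v *)
Require Import Defs.
From mathcomp Require Import all_boot all_order all_algebra.
From mathcomp Require Import all_fingroup.
From mathcomp Require Import all_classical all_reals all_analysis.
From mathcomp Require Import zify ring lra.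

Set Implicit Arguments.
Unset Strict Implicit.
Unset Printing Implicit Defensive.

Import Order.TTheory GRing.Theory Num.Theory.
Import numFieldNormedType.Exports.

Local Open Scope classical_set_scope.
Local Open Scope ring_scope.


(** Write F for the additive functional with toll f, V_n = Var F(T_n),
nu_n = E F(T_n), mu_n = E f(T_n) and v_n = Var f(T_n).

Given the rank of the first key, the two subtrees of the root of a random
binary search tree are independent random binary search trees
([bst_expectS]).  When the toll depends only on the sizes, F(T_n) is therefore
a sum of two independent copies of F plus a function of the split, and the law
of total variance gives the quicksort recurrence

  V_n = (2/n) (V_0 + ... + V_(n-1)) + psi_n

([bst_var_rec]); nu_n obeys the same recurrence with mu_n in place of psi_n.
Its solution is V_n = (n+1) S_n + psi_n, where S_n is the sum over k < n of
2 psi_k / ((k+1)(k+2)) ([quicksort_solution]).  So V_n / n tends to the sum of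
the series as soon as that series converges and psi_n = o(n).

Both facts are proved by estimating psi_n.  The solution of the recurrence for
the means shows that nu_n = (n+1) c + eta_n, where c is the sum of the series
with general term 2 mu_k / ((k+1)(k+2)).  As (i+1) + (n-1-i+1) = n+1 does not
depend on the split i, the linear part of nu contributes nothing to psi_n, and

  psi_n <= 3 v_n + (6/n) (eta_0^2 + ... + eta_(n-1)^2)

([psiF_le]).  A discrete Hardy inequality ([hardy_tail]) turns the hypothesis
that mu_k^2 / k^2 is summable into summability of eta_k^2 / k^2
([quicksort_mean_fluctuation]); the averages above are then o(n) by Kronecker's
lemma ([kronecker]) and summable against 1/k^2 by Abel summation
([toll_sum_average]).  The terms v_k / k^2 are summable because they are the
product of sqrt v_k / k^(3/2) with the bounded factor sqrt (v_k / k).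

Finally psi_k >= 0 for all k, so the limit vanishes only if all psi_k do, which
by the recurrence is the case exactly when all V_n vanish.  Then the split at
the root does not change nu_i + nu_(n-1-i) + g, so g is the coboundary of nu;
conversely a coboundary telescopes along the tree ([deterministic_iff_coboundary]). *)

(** * Averages over the permutations of a word *)

Section PermutationAverage.
Context {R : realType}.

Definition perm_avg (T : eqType) (X : seq T) (P : seq T -> R) : R :=
  (\sum_(w <- permutations X) P w) / (size X)`!%:R.

(** Conditioning on the first letter: it is uniform on X, and the rest of the word
is a uniform permutation of the remaining letters. *)
Lemma perm_avg_cons (T : eqType) (X : seq T) (P : seq T -> R) :
  uniq X -> (0 < size X)%N ->
  perm_avg X P =
  (\sum_(x <- X) perm_avg (rem x X) (fun w => P (x :: w))) / (size X)%:R.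
Proof.
move=> uX X0; rewrite /perm_avg (perm_big _ (permutationsE X0)) /= undup_id //.
rewrite big_allpairs_dep /= -(prednK X0) factS natrM invfM mulrA.
rewrite [_ / _ / _]mulrAC mulr_suml; congr (_ / _).
by rewrite !big_seq; apply: eq_bigr => x xX; rewrite size_rem.
Qed.

Lemma eq_perm_avg (T : eqType) (X : seq T) (P Q : seq T -> R) :
  P =1 Q -> perm_avg X P = perm_avg X Q.
Proof. by move=> PQ; rewrite /perm_avg (eq_bigr Q). Qed.

Lemma perm_avg_nil (T : eqType) (P : seq T -> R) : perm_avg [::] P = P [::].
Proof. by rewrite /perm_avg big_seq1 divr1. Qed.

Lemma perm_avg_exchange (T U : eqType) (X : seq T) (Y : seq U)
    (P : seq T -> seq U -> R) :
  perm_avg X (fun u => perm_avg Y (P u)) =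
  perm_avg Y (fun v => perm_avg X (P^~ v)).
Proof.
by rewrite /perm_avg -!mulr_suml mulrAC exchange_big.
Qed.

(** In a uniform permutation the subwords of the letters satisfying p and of the
others are independent and uniform.  By induction on the length, conditioning on
the first letter: by the induction hypothesis the letters satisfying p
contribute (number of such letters) times the double average, again by
[perm_avg_cons] read backwards, and likewise for the other letters. *)
Lemma perm_avg_split (T : eqType) (p : pred T) (X : seq T)
    (P : seq T -> seq T -> R) : uniq X ->
  perm_avg X (fun w => P (seq.filter p w) (seq.filter (predC p) w)) =
  perm_avg (seq.filter p X)
    (fun u => perm_avg (seq.filter (predC p) X) (P u)).
Proof.
move eN : (size X) => n; elim: n X P eN => [|n IH] X P eN uX.
  by rewrite (size0nil eN) /= !perm_avg_nil.
rewrite perm_avg_cons ?eN //.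
set A := RHS.
have Epos : \sum_(x <- X | p x)
    perm_avg (rem x X) (fun w => P (seq.filter p (x :: w)) (seq.filter (predC p) (x :: w)))
   = (size (seq.filter p X))%:R * A.
  (* with no letter satisfying p there is no first letter to condition on,
     and both sides are 0 *)
  have [s0|s0] := posnP (size (seq.filter p X)).
    by rewrite s0 mul0r -big_filter (size0nil s0) big_nil.
  rewrite /A (perm_avg_cons _ _ s0) ?filter_uniq //
    mulrCA mulfV ?mulr1; last first.
    by rewrite pnatr_eq0 -lt0n.
  rewrite big_filter [LHS]big_seq_cond [RHS]big_seq_cond.
  apply: eq_bigr => x /andP[xX px] /=.
  rewrite px /= (IH _ (fun u v => P (x :: u) v)) ?rem_uniq ?size_rem ?eN //.
  rewrite !rem_filter ?filter_uniq //.
  rewrite -!filter_predI.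
  rewrite (@eq_filter _ (predI (predC p) (predC1 x)) (predC p)); last first.
    by move=> y /=; have [->|//] := eqVneq y x; rewrite ?px ?andbF ?andbT.
  rewrite (@eq_filter _ (predI p (predC1 x)) (predI (predC1 x) p)) //.
  by move=> y /=; rewrite andbC.
have Eneg : \sum_(x <- X | predC p x)
    perm_avg (rem x X) (fun w => P (seq.filter p (x :: w)) (seq.filter (predC p) (x :: w)))
   = (size (seq.filter (predC p) X))%:R * A.
  have [s0|s0] := posnP (size (seq.filter (predC p) X)).
    by rewrite s0 mul0r -big_filter (size0nil s0) big_nil.
  rewrite /A perm_avg_exchange (perm_avg_cons _ _ s0) ?filter_uniq //
    mulrCA mulfV ?mulr1; last first.
    by rewrite pnatr_eq0 -lt0n.
  rewrite big_filter [LHS]big_seq_cond [RHS]big_seq_cond.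
  apply: eq_bigr => x /andP[xX /= px] /=.
  rewrite px (negbTE px) /= (IH _ (fun u v => P u (x :: v))) ?rem_uniq ?size_rem ?eN //.
  rewrite perm_avg_exchange.
  rewrite !rem_filter ?filter_uniq //.
  rewrite -!filter_predI.
  rewrite (@eq_filter _ (predI p (predC1 x)) p); last first.
    by move=> y /=; have [->|//] := eqVneq y x; rewrite ?(negbTE px) ?andbF ?andbT.
  rewrite (@eq_filter _ (predI (predC p) (predC1 x)) (predI (predC1 x) (predC p))) //.
  by move=> y /=; rewrite andbC.
rewrite (bigID p) /= Epos Eneg -mulrDl -natrD !size_filter count_predC eN.
by rewrite mulrAC mulfV ?mul1r // pnatr_eq0.
Qed.

End PermutationAverage.

(** * The recursive structure of the random binary search tree *)

Section RandomBst.
Context {R : realType}.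

(** Once the root is occupied, the smaller keys build the left subtree and the
other keys build the right subtree, without interaction. *)
Lemma foldl_kt_insert (l r : keyed_tree) (y : nat) (w : seq nat) :
  foldl kt_insert (Kt_node l y r) w =
  Kt_node (foldl kt_insert l [seq x <- w | (x < y)%N]) y
          (foldl kt_insert r [seq x <- w | ~~ (x < y)%N]).
Proof. by elim: w l r => //= x w IH l r; case: ifP => _; rewrite IH. Qed.

Definition word_tree (w : seq nat) : bintree :=
  kt_shape (foldl kt_insert Kt_empty w).

Lemma word_tree_cons (x : nat) (w : seq nat) :
  word_tree (x :: w) = Bt_node (word_tree [seq y <- w | (y < x)%N])
                               (word_tree [seq y <- w | ~~ (y < x)%N]).
Proof. by rewrite /word_tree /= foldl_kt_insert. Qed.

(** The starting point a is kept free because the subtrees of the root are built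
from intervals of keys that do not start at 1. *)
Definition iota_expect (a n : nat) (h : bintree -> R) : R :=
  perm_avg (iota a n) (h \o word_tree).

Lemma rem_iota_split (a n i : nat) : (i <= n)%N ->
  [seq y <- rem (a + i)%N (iota a n.+1) | (y < a + i)%N] = iota a i /\
  [seq y <- rem (a + i)%N (iota a n.+1) | ~~ (y < a + i)%N] =
    iota (a + i).+1 (n - i)%N.
Proof.
move=> lin.
have E : iota a n.+1 = iota a i ++ (a + i)%N :: iota (a + i).+1 (n - i)%N.
  by rewrite -[_ :: _]/(iota (a + i) (n - i).+1) -iotaD -subSn // addnC subnK // ltnW.
rewrite rem_filter ?iota_uniq // E filter_cat /= eqxx /=.
have E1 : [seq x <- iota a i | predC1 (a + i)%N x] = iota a i.
  by apply/all_filterP/allP => x; rewrite mem_iota /= => /andP[_ xi]; rewrite ltn_eqF.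
have E2 : [seq x <- iota (a + i).+1 (n - i) | predC1 (a + i)%N x] = iota (a + i).+1 (n - i).
  by apply/all_filterP/allP => x; rewrite mem_iota /= => /andP[xi _]; rewrite gtn_eqF.
rewrite E1 E2 !filter_cat; split.
  rewrite (eq_in_filter (a2 := predT) (s := iota a i)) ?filter_predT; last first.
    by move=> x; rewrite mem_iota => /andP[_ ->].
  rewrite (eq_in_filter (a2 := pred0)) ?filter_pred0 ?cats0 // => x.
  by rewrite mem_iota => /andP[xi _]; rewrite ltnNge ltnW.
rewrite (eq_in_filter (a2 := pred0) (s := iota a i)) ?filter_pred0 /=; last first.
  by move=> x; rewrite mem_iota => /andP[_ ->].
apply/all_filterP/allP => x; rewrite mem_iota => /andP[xi _].
by rewrite -leqNgt ltnW.
Qed.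

(** Condition on the first key a + i, then split the remaining keys into the
smaller and the larger ones, which form two intervals. *)
Lemma iota_expectS (a n : nat) (h : bintree -> R) :
  iota_expect a n.+1 h =
  (\sum_(i < n.+1) iota_expect a i (fun l =>
     iota_expect (a + i).+1 (n - i) (fun r => h (Bt_node l r)))) / n.+1%:R.
Proof.
rewrite /iota_expect perm_avg_cons ?iota_uniq ?size_iota //; congr (_ / _).
rewrite -[a in LHS]addn0 iotaDl big_map -[iota 0 _]/(index_iota 0 n.+1) big_mkord.
apply: eq_bigr => i _; rewrite -iotaDl addn0.
have [E1 E2] := @rem_iota_split a n i (ltn_ord i).
rewrite (eq_perm_avg _ (Q := fun w => (fun u v =>
   h (Bt_node (word_tree u) (word_tree v)))
   [seq y <- w | (y < a + i)%N] [seq y <- w | ~~ (y < a + i)%N])); last first.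
  by move=> w /=; rewrite word_tree_cons.
rewrite (perm_avg_split (fun y => (y < a + i)%N) (fun u v =>
   h (Bt_node (word_tree u) (word_tree v)))) ?rem_uniq ?iota_uniq //.
by rewrite E1 E2.
Qed.

(** The recursion [iota_expectS] sees only the number of keys, not their values. *)
Lemma iota_expect_shift (a b n : nat) (h : bintree -> R) :
  iota_expect a n h = iota_expect b n h.
Proof.
elim/ltn_ind: n a b h => -[_|n IH] a b h.
  by rewrite /iota_expect /= !perm_avg_nil.
rewrite !iota_expectS; congr (_ / _); apply: eq_bigr => i _.
rewrite (IH i _ a b) //; apply: eq_perm_avg => w /=.
by apply: IH; rewrite ltnS leq_subr.
Qed.

(** The map sending a permutation to its word of keys is a bijection onto the
permutations of the word 1 ... n. *)
Lemma bst_expectE (n : nat) (h : bintree -> R) :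
  bst_expect n h = iota_expect 1 n h.
Proof.
pose word (s : 'S_n) := [seq (s i).+1 | i <- enum 'I_n].
rewrite /bst_expect /unif_expect /iota_expect /perm_avg size_iota card_Sn.
congr (_ / _).
have word_inj : injective word.
  move=> s t /eq_in_map E; apply/permP => i; apply/val_inj.
  by have [] := E i (mem_enum _ _).
have uW : uniq [seq word s | s <- enum 'S_n] by rewrite map_inj_uniq // enum_uniq.
have sW : {subset [seq word s | s <- enum 'S_n] <= permutations (iota 1 n)}.
  move=> w /mapP[s _ ->]; rewrite mem_permutations; apply: uniq_perm.
  - rewrite map_inj_uniq ?enum_uniq // => i j [] /val_inj; exact: perm_inj.
  - exact: iota_uniq.
  move=> x; rewrite mem_iota add1n; apply/mapP/andP => [[i _ ->]|[x0 xn]].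
    by split=> //; exact: ltn_ord.
  have xn' : (x.-1 < n)%N by rewrite prednK.
  exists (perm_inv s (Ordinal xn')); first by rewrite mem_enum.
  by rewrite permKV /= prednK.
have [|E1 E2] := uniq_min_size uW sW.
  by rewrite size_permutations ?iota_uniq // size_iota size_map -cardE card_Sn.
rewrite -(perm_big _ (uniq_perm uW (permutations_uniq _) E2)) big_map.
by rewrite big_enum.
Qed.

End RandomBst.

(** * Uniform expectation and variance *)

Section UniformMoments.
Context {R : realType}.

Lemma eq_unif_expect (Omega : finType) (X Y : Omega -> R) :
  X =1 Y -> unif_expect X = unif_expect Y.
Proof. by move=> XY; rewrite /unif_expect (eq_bigr Y). Qed.

Lemma unif_expectD (Omega : finType) (X Y : Omega -> R) :
  unif_expect (fun w => X w + Y w) = unif_expect X + unif_expect Y.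
Proof. by rewrite /unif_expect big_split mulrDl. Qed.

Lemma unif_expectZ (Omega : finType) (c : R) (X : Omega -> R) :
  unif_expect (fun w => c * X w) = c * unif_expect X.
Proof. by rewrite /unif_expect -mulr_sumr mulrA. Qed.

Lemma unif_expect_cst (Omega : finType) (c : R) :
  (0 < #|Omega|)%N -> unif_expect (fun _ : Omega => c) = c.
Proof.
move=> O0; rewrite /unif_expect sumr_const -[c *+ _]mulr_natr mulfK //.
by rewrite pnatr_eq0 -lt0n.
Qed.

Lemma le_unif_expect (Omega : finType) (X Y : Omega -> R) :
  (forall w, X w <= Y w) -> unif_expect X <= unif_expect Y.
Proof.
by move=> XY; rewrite /unif_expect ler_wpM2r ?invr_ge0 //; apply: ler_sum.
Qed.

Lemma unif_var_ge0 (Omega : finType) (X : Omega -> R) : 0 <= unif_var X.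
Proof.
by rewrite divr_ge0 //; apply: sumr_ge0 => w _; apply: sqr_ge0.
Qed.

(** Bias-variance decomposition: the cross term has mean 0. *)
Lemma unif_expect_sqrD (Omega : finType) (X : Omega -> R) (c : R) :
  (0 < #|Omega|)%N ->
  unif_expect (fun w => (X w + c) ^+ 2) =
  unif_var X + (unif_expect X + c) ^+ 2.
Proof.
move=> O0; set m := unif_expect X.
rewrite (eq_unif_expect (Y := fun w => (X w - m) ^+ 2 +
   ((m + c) ^+ 2 + (2 * (m + c)) * (X w + - m)))); last by move=> w; ring.
rewrite unif_expectD; congr (_ + _).
rewrite unif_expectD unif_expectZ unif_expectD !unif_expect_cst //.
by rewrite subrr mulr0 addr0.
Qed.

Lemma unif_var_le (Omega : finType) (X : Omega -> R) (c : R) :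
  (0 < #|Omega|)%N -> unif_var X <= unif_expect (fun w => (X w - c) ^+ 2).
Proof. by move=> O0; rewrite unif_expect_sqrD // lerDl sqr_ge0. Qed.

Lemma unif_var_eq0 (Omega : finType) (X : Omega -> R) :
  unif_var X = 0 -> forall w, X w = unif_expect X.
Proof.
move=> V0 w; have O0 : (0 < #|Omega|)%N by apply/card_gt0P; exists w.
move: V0 => /eqP; rewrite /unif_var {1}/unif_expect mulf_eq0 invr_eq0 pnatr_eq0.
rewrite -[_ == 0%N]negbK -lt0n O0 orbF psumr_eq0; last first.
  by move=> ? _; apply: sqr_ge0.
by move/allP/(_ w (mem_index_enum _)) => /=; rewrite sqrf_eq0 subr_eq0 => /eqP.
Qed.

Lemma unif_expect_rev (n : nat) (x : nat -> R) :
  unif_expect (fun i : 'I_n.+1 => x (n - i)%N) =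
  unif_expect (fun i : 'I_n.+1 => x i).
Proof.
rewrite /unif_expect (reindex_inj rev_ord_inj) /=; congr (_ / _).
by apply: eq_bigr => i _; rewrite subSS subKn // -ltnS.
Qed.

End UniformMoments.

(** * Recurrences for the mean and the variance *)

Section BstRecursion.
Context {R : realType}.

Lemma bst_expect0 (h : bintree -> R) : bst_expect 0 h = h Bt_empty.
Proof. by rewrite bst_expectE /iota_expect perm_avg_nil. Qed.

(** The rank of the root is uniform, and given that rank the two subtrees are
independent random binary search trees. *)
Lemma bst_expectS (n : nat) (h : bintree -> R) :
  bst_expect n.+1 h = unif_expect (fun i : 'I_n.+1 =>
    bst_expect i (fun l => bst_expect (n - i) (fun r => h (Bt_node l r)))).
Proof.
rewrite bst_expectE iota_expectS /unif_expect card_ord; congr (_ / _).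
apply: eq_bigr => i _; rewrite bst_expectE; apply: eq_perm_avg => w /=.
by rewrite bst_expectE; apply: iota_expect_shift.
Qed.

Lemma eq_bst_expect (n : nat) (h k : bintree -> R) :
  (forall T, bt_size T = n -> h T = k T) -> bst_expect n h = bst_expect n k.
Proof.
elim/ltn_ind: n h k => -[_|n IH] h k hk; first by rewrite !bst_expect0 hk.
rewrite !bst_expectS; apply: eq_unif_expect => i; apply: (IH i) => // l sl.
apply: (IH (n - i)%N) => [|r sr]; first by rewrite ltnS leq_subr.
by apply: hk; rewrite /= sl sr subnKC // -ltnS.
Qed.

Lemma card_bst_space_gt0 (n : nat) : (0 < #|{: 'S_n}|)%N.
Proof. by rewrite card_Sn fact_gt0. Qed.

Lemma bst_expect_cst (n : nat) (c : R) : bst_expect n (fun=> c) = c.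
Proof. by rewrite /bst_expect unif_expect_cst ?card_bst_space_gt0. Qed.

Lemma bst_expectD (n : nat) (h k : bintree -> R) :
  bst_expect n (fun T => h T + k T) = bst_expect n h + bst_expect n k.
Proof. exact: unif_expectD. Qed.

Lemma additive_functional_node (f : bintree -> R) (l r : bintree) :
  additive_functional f (Bt_node l r) =
  additive_functional f l + additive_functional f r + f (Bt_node l r).
Proof.
by rewrite /additive_functional /= big_cons big_cat !big_map [RHS]addrC.
Qed.

Variables (f : bintree -> R) (g : nat -> nat -> nat -> R).
Hypothesis Hsizes : forall l r : bintree,
  f (Bt_node l r) = g (bt_size (Bt_node l r)) (bt_size l) (bt_size r).

Local Notation F := (additive_functional f).

(** The toll sees the tree only through the sizes of the two subtrees, hence
through a uniform split. *)
Lemma bst_expect_toll (h : R -> R) (n : nat) :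
  bst_expect n.+1 (h \o f) =
  unif_expect (fun i : 'I_n.+1 => h (g n.+1 i (n - i)%N)).
Proof.
rewrite bst_expectS; apply: eq_unif_expect => i.
have szi : (i + (n - i))%N = n by rewrite subnKC // -ltnS.
rewrite -[RHS](bst_expect_cst i).
apply: eq_bst_expect => l sl.
rewrite -[RHS](bst_expect_cst (n - i)).
by apply: eq_bst_expect => r sr /=; rewrite Hsizes /= sl sr szi.
Qed.

(** The toll at the root is constant once the split is known; h is applied to the
whole value so that the lemma serves for means and for squares. *)
Lemma bst_expect_nodeE (n : nat) (i : 'I_n.+1) (h : R -> R) :
  bst_expect i (fun l => bst_expect (n - i) (fun r => h (F (Bt_node l r)))) =
  bst_expect i (fun l => bst_expect (n - i) (fun r =>
    h (F l + F r + g n.+1 i (n - i)%N))).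
Proof.
apply: eq_bst_expect => l sl; apply: eq_bst_expect => r sr.
rewrite additive_functional_node Hsizes /= sl sr.
by rewrite subnKC // -ltnS.
Qed.

Lemma nuF_root_split (n : nat) :
  nuF f n.+1 = unif_expect (@root_split _ f g n.+1).
Proof.
rewrite /nuF bst_expectS; apply: eq_unif_expect => i.
rewrite (bst_expect_nodeE i id) /root_split subn1 /=.
set c := g _ _ _.
rewrite (eq_bst_expect (k := fun l => F l + (nuF f (n - i) + c))).
  by rewrite bst_expectD bst_expect_cst addrA.
by move=> l _; rewrite !bst_expectD !bst_expect_cst addrA.
Qed.

(** The law of total variance: the bias-variance decomposition is applied to the
right subtree with the left one fixed, then to the left subtree; the two biases
add up to the deviation of the split from the mean. *)
Lemma bst_varS (n : nat) :
  bst_var n.+1 F = unif_expect (fun i : 'I_n.+1 =>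
    bst_var i F + bst_var (n - i) F) + psiF f g n.+1.
Proof.
rewrite {1}/bst_var {1}/unif_var -/(bst_expect _ _) -/(nuF f n.+1).
rewrite -[LHS]/(bst_expect n.+1 (fun T => (F T - nuF f n.+1) ^+ 2)) bst_expectS.
rewrite /psiF /unif_var -nuF_root_split -unif_expectD.
apply: eq_unif_expect => i.
rewrite (bst_expect_nodeE i (fun x => (x - nuF f n.+1) ^+ 2)).
rewrite /root_split subn1 /=; set c := g _ _ _.
rewrite /bst_expect.
rewrite (eq_unif_expect (Y := fun s : 'S_i => bst_var (n - i) F +
  (F (bst s) + (nuF f (n - i) + c - nuF f n.+1)) ^+ 2)); last first.
  move=> s /=.
  rewrite (eq_unif_expect (Y := fun t : 'S_(n - i) =>
    (F (bst t) + (F (bst s) + c - nuF f n.+1)) ^+ 2)); last by move=> t /=; ring.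
  rewrite unif_expect_sqrD ?card_bst_space_gt0 // -/(bst_var _ _).
  by congr (_ + _ ^+ 2); rewrite -/(bst_expect _ _) -/(nuF _ _); ring.
rewrite unif_expectD unif_expect_cst ?card_bst_space_gt0 //.
rewrite unif_expect_sqrD ?card_bst_space_gt0 // -!/(bst_var _ _).
rewrite -/(bst_expect _ _) -/(nuF _ _). ring.
Qed.

Lemma bst_var0 (h : bintree -> R) : bst_var 0 h = 0.
Proof.
rewrite -[LHS]/(bst_expect 0 (fun T => (h T - bst_expect 0 h) ^+ 2)).
by rewrite !bst_expect0 subrr expr0n.
Qed.

Lemma nuF0 : nuF f 0 = 0.
Proof. by rewrite /nuF bst_expect0 /additive_functional big_nil. Qed.

Lemma unif_expect_two_sides (n : nat) (x : nat -> R) :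
  unif_expect (fun i : 'I_n.+1 => x i + x (n - i)%N) =
  2 / n.+1%:R * \sum_(i < n.+1) x i.
Proof.
rewrite unif_expectD unif_expect_rev /unif_expect card_ord.
by ring.
Qed.

Lemma nuFS (n : nat) :
  nuF f n.+1 = 2 / n.+1%:R * \sum_(i < n.+1) nuF f i + bst_expect n.+1 f.
Proof.
rewrite nuF_root_split -(unif_expect_two_sides n (nuF f)) (bst_expect_toll id).
by rewrite -unif_expectD; apply: eq_unif_expect => i; rewrite /root_split subn1.
Qed.

Lemma bst_var_rec (n : nat) :
  bst_var n.+1 F = 2 / n.+1%:R * \sum_(i < n.+1) bst_var i F + psiF f g n.+1.
Proof. by rewrite bst_varS -(unif_expect_two_sides n (fun i => bst_var i F)). Qed.

Lemma bst_var_toll (n : nat) :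
  bst_var n.+1 f = unif_var (fun i : 'I_n.+1 => g n.+1 i (n - i)%N).
Proof.
rewrite /unif_var -(bst_expect_toll id).
by rewrite -(bst_expect_toll (fun x => (x - bst_expect n.+1 f) ^+ 2)).
Qed.

(** A variance is at most the mean square deviation from any constant.  The
constant (n+2) c + E f(T_(n+1)) absorbs the linear part of the means, since the
sizes of the two subtrees, each increased by 1, add up to n + 2.  What remains
is eta i + eta (n - i) + (toll - its mean), whose square is at most three times
the sum of the three squares. *)
Lemma psiF_le (n : nat) (c : R) (eta := fun i => nuF f i - i.+1%:R * c) :
  psiF f g n.+1 <=
  3 * bst_var n.+1 f + 6 / n.+1%:R * \sum_(i < n.+1) eta i ^+ 2.
Proof.
have On : (0 < #|{: 'I_n.+1}|)%N by rewrite card_ord.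
apply: (le_trans (unif_var_le _ (n.+2%:R * c + bst_expect n.+1 f) On)).
have -> : 3 * bst_var n.+1 f + 6 / n.+1%:R * \sum_(i < n.+1) eta i ^+ 2 =
  unif_expect (fun i : 'I_n.+1 => 3 * (g n.+1 i (n - i)%N - bst_expect n.+1 f) ^+ 2
    + 3 * (eta i ^+ 2 + eta (n - i)%N ^+ 2)).
  rewrite unif_expectD !unif_expectZ bst_var_toll /unif_var (bst_expect_toll id).
  by rewrite (unif_expect_two_sides n (fun i => eta i ^+ 2)); field.
apply: le_unif_expect => i; rewrite /root_split subn1 /=.
set y := _ - bst_expect n.+1 f.
have -> : nuF f i + nuF f (n - i) + g n.+1 i (n - i)%N -
    (n.+2%:R * c + bst_expect n.+1 f) = eta i + eta (n - i)%N + y.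
  have -> : n.+2%:R = i.+1%:R + (n - i).+1%:R :> R.
    by rewrite -natrD addSn addnS subnKC // -ltnS.
  by rewrite /eta /y; ring.
move: (eta i) (eta (n - i)%N) => a b.
have := sqr_ge0 (a - b); have := sqr_ge0 (b - y); have := sqr_ge0 (a - y).
by rewrite !expr2; lra.
Qed.

End BstRecursion.

(** * The quicksort recurrence and series estimates *)

Section Analysis.
Context {R : realType}.
Implicit Types (u w x y r : nat -> R).

(** These weights are the coefficients with which the tolls enter the solution
of the quicksort recurrence; see [quicksort_solution]. *)
Definition toll_sum y (n : nat) : R :=
  \sum_(1 <= k < n) 2 / (k.+1%:R * k.+2%:R) * y k.

Lemma toll_sumS y (n : nat) :
  toll_sum y n.+2 = toll_sum y n.+1 + 2 / (n.+2%:R * n.+3%:R) * y n.+1.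
Proof. by rewrite /toll_sum big_nat_recr. Qed.

(** Dividing x_0 + ... + x_m by (m+1)(m+2)/2 turns the recurrence into a
telescoping one, whose increments are the weighted tolls. *)
Lemma quicksort_solution x y : x 0%N = 0 ->
  (forall n, x n.+1 = 2 / n.+1%:R * (\sum_(i < n.+1) x i) + y n.+1) ->
  forall n, x n.+1 = n.+2%:R * toll_sum y n.+1 + y n.+1.
Proof.
move=> x0 xS n.
suff E m : \sum_(i < m.+1) x i = m.+1%:R * m.+2%:R / 2 * toll_sum y m.+1.
  by rewrite xS E; congr (_ + _); field; rewrite nat1r pnatr_eq0.
elim: m => [|m IH].
  by rewrite big_ord1 x0 /toll_sum big_geq // mulr0.
rewrite big_ord_recr /= xS IH toll_sumS.
by field; rewrite ?nat1r -!natrD !pnatr_eq0.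
Qed.

(** A discrete Hardy inequality for tails of series: when r L = 0, the sequence r
is controlled in l2 by n times its increments.  The boundary term makes an
induction on L possible; the step is a positive semidefinite quadratic form in
r L and r (L+1), and 16 is a convenient constant for which it is one. *)
Lemma hardy_tail r (L : nat) :
  \sum_(1 <= n < L) r n ^+ 2 <=
  16 * \sum_(1 <= n < L) (n%:R * (r n - r n.+1)) ^+ 2 + 2 * L%:R * r L ^+ 2.
Proof.
elim: L => [|[|L] IH]; first by rewrite !big_geq // !mulr0 mul0r addr0.
  by rewrite !big_geq // mulr0 add0r mulr1 mulr_ge0 // sqr_ge0.
rewrite big_nat_recr //= [in leRHS]big_nat_recr //= mulrDr.
apply: (le_trans (lerD IH (lexx _))).
rewrite -!addrA lerD2l.
set a := r L.+1; set b := r L.+2; rewrite -[L.+2%:R]natr1.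
have l1 : 1 <= L.+1%:R :> R by rewrite ler1n.
set l : R := L.+1%:R in l1 *.
(* in terms of the increment d, the form is a square plus a multiple of d^2
   whose coefficient is nonnegative because l >= 1 *)
have -> : a = (a - b) + b by ring.
set d := a - b; rewrite addrK.
rewrite -subr_ge0.
have -> : 16 * (l * d) ^+ 2 + 2 * (l + 1) * b ^+ 2 -
    (2 * l * (d + b) ^+ 2 + (d + b) ^+ 2) =
  (b - (2 * l + 1) * d) ^+ 2 + (12 * l ^+ 2 - 6 * l - 2) * d ^+ 2 by ring.
rewrite addr_ge0 ?sqr_ge0 // mulr_ge0 ?sqr_ge0 //.
by rewrite expr2; nra.
Qed.

Lemma psum_nondecreasing u : (forall k, (0 < k)%N -> 0 <= u k) ->
  {homo (fun n => \sum_(1 <= k < n) u k) : m n / (m <= n)%N >-> m <= n}.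
Proof.
move=> u0 m n mn; case: m mn => [|m] mn.
  rewrite big_geq // big_nat_cond; apply: sumr_ge0 => k.
  by rewrite andbT => /andP[k0 _]; apply: u0.
rewrite [leRHS](big_cat_nat (n := m.+1)) //= lerDl big_nat_cond.
by apply: sumr_ge0 => k /andP[/andP[k0 _] _]; apply/u0/(leq_trans _ k0).
Qed.

Lemma psum_is_cvg u (M : R) : (forall k, (0 < k)%N -> 0 <= u k) ->
  (forall n, \sum_(1 <= k < n) u k <= M) ->
  cvgn (fun n => \sum_(1 <= k < n) u k).
Proof.
move=> u0 uM; apply: nondecreasing_is_cvgn; first exact: psum_nondecreasing.
by exists M => _ [n _ <-].
Qed.

Lemma ler_psum u w (n : nat) : (forall k, (0 < k)%N -> u k <= w k) ->
  \sum_(1 <= k < n) u k <= \sum_(1 <= k < n) w k.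
Proof.
move=> uw; rewrite [leLHS]big_nat_cond [leRHS]big_nat_cond.
apply: ler_sum => k /andP[/andP[k0 _] _].
exact: uw.
Qed.

(** The terms are the differences 1/(k+1) - 1/(k+2). *)
Lemma telescope_inv_le (n : nat) :
  \sum_(1 <= k < n) (k.+1%:R * k.+2%:R)^-1 <= 1 :> R.
Proof.
suff : \sum_(1 <= k < n.+1) (k.+1%:R * k.+2%:R)^-1 = 2^-1 - n.+2%:R^-1 :> R.
  case: n => [|n]; first by rewrite big_geq.
  move=> E; apply: (le_trans (psum_nondecreasing _ (leqnSn n.+1))).
    by move=> k _; rewrite invr_ge0 mulr_ge0.
  rewrite E; have : 0 <= n.+3%:R^-1 :> R by rewrite invr_ge0.
  move: (n.+3%:R^-1) => t t0.
  lra.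
elim: n => [|n IH]; first by rewrite big_geq // subrr.
rewrite big_nat_recr //= IH.
by field; rewrite ?nat1r -!natrD !pnatr_eq0.
Qed.

Section Mean.
Variables (y : nat -> R) (B : R).
Hypothesis yB : forall n, \sum_(1 <= k < n) y k ^+ 2 / k%:R ^+ 2 <= B.

(** Absolute convergence, from 2 |y| <= y^2 + 1. *)
Lemma toll_sum_is_cvg : cvgn (toll_sum y).
Proof.
pose d k := 2 / (k.+1%:R * k.+2%:R) * y k : R.
have dB n : \sum_(1 <= k < n) `|d k| <= B + 1.
  apply: (le_trans _ (lerD (yB n) (telescope_inv_le n))).
  rewrite -big_split /=; apply: ler_psum => k k0.
  have k0R : 0 < k%:R :> R by rewrite ltr0n.
  rewrite /d normrM ger0_norm ?divr_ge0 ?mulr_ge0 //.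
  set p : R := k.+1%:R * k.+2%:R; rewrite mulrAC.
  have p0 : 0 < p by rewrite mulr_gt0.
  apply: (@le_trans _ _ ((y k ^+ 2 + 1) / p)).
    rewrite ler_wpM2r ?invr_ge0 ?(ltW p0) // -real_normK ?num_real //.
    by have := sqr_ge0 (`|y k| - 1); rewrite !expr2; lra.
  rewrite mulrDl mul1r lerD2r ler_wpM2l ?sqr_ge0 // lef_pV2 ?posrE ?exprn_gt0 //.
  by rewrite /p -![_.+1%:R]natr1 expr2; nra.
have c1 : cvgn (fun n => \sum_(1 <= k < n) `|d k|) by apply: psum_is_cvg dB.
have c2 : cvgn (fun n => \sum_(1 <= k < n) (`|d k| + d k)).
  apply: (@psum_is_cvg _ (2 * (B + 1))) => [k _|n].
    by have := ler_norm (- d k); rewrite normrN; lra.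
  apply: (@le_trans _ _ (\sum_(1 <= k < n) 2 * `|d k|)).
    by apply: ler_psum => k _; have := ler_norm (d k); lra.
  by rewrite -mulr_sumr ler_wpM2l.
have -> : toll_sum y = (fun n => \sum_(1 <= k < n) (`|d k| + d k)) -
                       (fun n => \sum_(1 <= k < n) `|d k|).
  by apply/funext => n; rewrite !fctE big_split /= addrAC subrr add0r.
exact: is_cvgB.
Qed.

Local Notation c := (limn (toll_sum y)).

(** Hardy's inequality is applied to the tail truncated at M, which vanishes at M,
so that no boundary term is left; then M tends to infinity. *)
Lemma toll_tail_square_sum (n : nat) :
  \sum_(1 <= k < n) (c - toll_sum y k) ^+ 2 <= 64 * B.
Proof.
have cvgn_lhs : (fun M => \sum_(1 <= k < n) (toll_sum y M - toll_sum y k) ^+ 2)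
   @ \oo --> \sum_(1 <= k < n) (c - toll_sum y k) ^+ 2.
  apply: cvg_big => [|k _]; first exact: add_continuous.
  have tail_cvg : toll_sum y M - toll_sum y k @[M --> \oo] --> c - toll_sum y k.
    by apply: cvgB; [exact: toll_sum_is_cvg | exact: cvg_cst].
  exact: (cvgM tail_cvg tail_cvg).
apply: (cvgr_to_le cvgn_lhs); exists n.+1 => // M /= nM.
apply: (@le_trans _ _ (\sum_(1 <= k < M) (toll_sum y M - toll_sum y k) ^+ 2)).
  by apply: psum_nondecreasing => [k _|]; [exact: sqr_ge0 | exact: ltnW].
apply: (le_trans (hardy_tail _ _)).
rewrite subrr expr0n /= mulr0 addr0.
apply: (@le_trans _ _ (16 * \sum_(1 <= k < M) 4 * (y k ^+ 2 / k%:R ^+ 2))).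
  rewrite ler_wpM2l //; apply: ler_psum => -[//|k] _.
  (* k times the k-th increment of toll_sum y is at most 2 |y k| / k *)
  rewrite toll_sumS.
  have -> : toll_sum y M - toll_sum y k.+1 - (toll_sum y M - (toll_sum y k.+1 +
    2 / (k.+2%:R * k.+3%:R) * y k.+1)) = 2 / (k.+2%:R * k.+3%:R) * y k.+1 by ring.
  have -> : 4 * (y k.+1 ^+ 2 / k.+1%:R ^+ 2) = (2 / k.+1%:R) ^+ 2 * y k.+1 ^+ 2.
    by field; rewrite ?nat1r pnatr_eq0.
  rewrite mulrA exprMn ler_wpM2r ?sqr_ge0 //.
  rewrite lerXn2r ?nnegrE ?mulr_ge0 ?divr_ge0 ?mulr_ge0 ?invr_ge0 //.
  rewrite mulrCA ler_wpM2l // ler_pdivrMr ?mulr_gt0 // mulrC ler_pdivlMr //.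
  by rewrite -!natrM ler_nat; nia.
by rewrite -mulr_sumr mulrA -natrM ler_wpM2l // yB.
Qed.

Variable x : nat -> R.
Hypotheses (x0 : x 0%N = 0)
  (xS : forall n, x n.+1 = 2 / n.+1%:R * (\sum_(i < n.+1) x i) + y n.+1).

(** After removal of its linear part, the solution of the recurrence is
y_k - (k+1) (c - toll_sum y k), and both terms are small in the weighted l2
sense.  The constant is 2 + 8 * 64, from (a - b)^2 <= 2 a^2 + 2 b^2,
(k+1)^2 <= 4 k^2 and [toll_tail_square_sum]. *)
Lemma quicksort_mean_fluctuation (n : nat) :
  \sum_(1 <= k < n) (x k - k.+1%:R * c) ^+ 2 / k%:R ^+ 2 <= 514 * B.
Proof.
have -> : 514 * B = 2 * B + 8 * (64 * B) by ring.
apply: (@le_trans _ _ (2 * (\sum_(1 <= k < n) y k ^+ 2 / k%:R ^+ 2) +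
   8 * \sum_(1 <= k < n) (c - toll_sum y k) ^+ 2)); last first.
  by rewrite lerD // ler_wpM2l // toll_tail_square_sum.
rewrite !mulr_sumr -big_split /=; apply: ler_psum => -[//|k] _.
rewrite (quicksort_solution x0 xS).
rewrite -[8 * _](mulfK (x := k.+1%:R ^+ 2)) ?expf_neq0 ?pnatr_eq0 // mulrA -mulrDl.
rewrite ler_wpM2r ?invr_ge0 ?exprn_ge0 // -[k.+2%:R]natr1.
have l1 : 1 <= k.+1%:R :> R by rewrite ler1n.
set l : R := k.+1%:R in l1 *.
set r := c - _; set z := y _.
have -> : (l + 1) * toll_sum y k.+1 + z - (l + 1) * c = z - (l + 1) * r.
  by rewrite /r; ring.
have := sqr_ge0 (z + (l + 1) * r).
have : 0 <= ((2 * l) ^+ 2 - (l + 1) ^+ 2) * r ^+ 2.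
  by rewrite mulr_ge0 ?sqr_ge0 // !expr2; nra.
by rewrite !expr2; lra.
Qed.

End Mean.

(** Kronecker's lemma for the weights 1/k^2: beyond a large N the terms of the
average are dominated by a small tail of the convergent series, and the first N
terms are killed by the factor 1/n^2. *)
Lemma kronecker w (C : R) : (forall k, 0 <= w k) ->
  (forall n, \sum_(1 <= k < n) w k / k%:R ^+ 2 <= C) ->
  (\sum_(i < n) w i) / n%:R ^+ 2 @[n --> \oo] --> (0 : R).
Proof.
move=> w0 wC; pose Q n := \sum_(1 <= k < n) w k / k%:R ^+ 2.
have t0 k : (0 < k)%N -> 0 <= w k / k%:R ^+ 2 by rewrite divr_ge0 ?exprn_ge0.
have cQ : cvgn Q by apply: psum_is_cvg wC.
have leQ := nondecreasing_cvgn_le (psum_nondecreasing t0) cQ.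
apply/cvgrPdist_lt => e e0.
have /cvgrPdist_lt/(_ (e / 2)) : Q @ \oo --> limn Q by [].
case=> [|N _ QN]; first by rewrite divr_gt0.
have {}QN : limn Q - Q N.+1 < e / 2.
  by apply: le_lt_trans (QN N.+1 (leqnSn N)); exact: ler_norm.
pose H := \sum_(i < N.+1) w i.
have H0 : 0 <= H by apply: sumr_ge0.
near=> n.
have Nn : (N < n)%N by near: n; exact: nbhs_infty_gt.
have n0 : 0 < n%:R :> R by rewrite ltr0n (leq_trans _ Nn).
rewrite sub0r normrN ger0_norm ?divr_ge0 ?sumr_ge0 ?exprn_ge0 //.
rewrite ltr_pdivrMr ?exprn_gt0 //.
have -> : \sum_(i < n) w i = H + \sum_(N.+1 <= i < n) w i.
  by rewrite -(big_mkord xpredT) (big_cat_nat (n := N.+1)) //= big_mkord.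
have t1 : \sum_(N.+1 <= i < n) w i <= n%:R ^+ 2 * (Q n - Q N.+1).
  rewrite /Q [X in X - _](big_cat_nat (n := N.+1)) //= addrC addrK mulr_sumr.
  rewrite [leLHS]big_nat_cond [leRHS]big_nat_cond.
apply: ler_sum => i /andP[/andP[Ni ni] _].
  have i0 : 0 < i%:R :> R by rewrite ltr0n (leq_trans _ Ni).
  rewrite mulrCA ler_peMr // ler_pdivlMr ?exprn_gt0 // mul1r.
  by rewrite lerXn2r ?nnegrE // ler_nat ltnW.
have t2 : H < e / 2 * n%:R ^+ 2.
  have : 2 * H / e < n%:R by near: n; exact: nbhs_infty_gtr.
  rewrite ltr_pdivrMr // => He.
  have n1 : 1 <= n%:R :> R by rewrite ler1n (leq_trans _ Nn).
  by rewrite expr2; nra.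
have t3 : n%:R ^+ 2 * (Q n - Q N.+1) <= n%:R ^+ 2 * (e / 2).
  rewrite ler_wpM2l ?exprn_ge0 //; apply: le_trans (ltW QN).
  by rewrite lerD2r; exact: leQ.
by lra.
Unshelve. all: by end_near. Qed.

(** Abel summation, based on
2 / (k (k+1) (k+2)) = 1 / (k (k+1)) - 1 / ((k+1) (k+2)). *)
Lemma toll_sum_average w (n : nat) :
  toll_sum (fun k => k%:R^-1 * \sum_(i < k) w i) n.+1 =
  w 0%N / 2 + \sum_(1 <= i < n.+1) w i / (i.+1%:R * i.+2%:R) -
  (\sum_(i < n.+1) w i) / (n.+1%:R * n.+2%:R).
Proof.
elim: n => [|n IH].
  by rewrite /toll_sum !big_geq // big_ord1; field.
rewrite toll_sumS IH [in RHS]big_nat_recr //= [in RHS]big_ord_recr /=.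
by field; rewrite ?nat1r -!natrD !pnatr_eq0.
Qed.

Lemma toll_sum_average_le w (C : R) : (forall k, 0 <= w k) ->
  (forall n, \sum_(1 <= k < n) w k / k%:R ^+ 2 <= C) ->
  forall n, toll_sum (fun k => k%:R^-1 * \sum_(i < k) w i) n <= w 0%N + C.
Proof.
move=> w0 wC [|n].
  rewrite /toll_sum big_geq // addr_ge0 //.
  by have := wC 0%N; rewrite big_geq.
rewrite toll_sum_average -[leRHS]subr0 lerB //; last first.
  by rewrite divr_ge0 ?mulr_ge0 ?sumr_ge0.
apply: lerD; first by have := w0 0%N; lra.
apply: le_trans (wC n.+1); apply: ler_psum => k k0.
rewrite ler_wpM2l // lef_pV2 ?posrE ?exprn_gt0 ?mulr_gt0 ?ltr0n //.
by rewrite -natrX -natrM ler_nat; nia.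
Qed.

(** v_k / k^2 is the product of sqrt v_k / k^(3/2) and sqrt (v_k / k). *)
Lemma toll_sum_var_le v (C M : R) : (forall k, 0 <= v k) ->
  (forall n, \sum_(1 <= k < n) Num.sqrt (v k) / k%:R `^ (3 / 2) <= C) ->
  (forall k, v k / k%:R <= M) ->
  forall n, toll_sum v n <= 2 * Num.sqrt M * C.
Proof.
move=> v0 vC vM n.
apply: (@le_trans _ _ (\sum_(1 <= k < n) 2 * Num.sqrt M *
    (Num.sqrt (v k) / k%:R `^ (3 / 2)))); last first.
  by rewrite -mulr_sumr ler_wpM2l ?mulr_ge0 ?sqrtr_ge0.
apply: ler_psum => k k0.
have k0R : 0 < k%:R :> R by rewrite ltr0n.
have -> : k%:R `^ (3 / 2) = k%:R * Num.sqrt k%:R :> R.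
  have -> : 3 / 2 = 1 + 2^-1 :> R by field.
  by rewrite powRD ?(gt_eqF k0R) ?implybT // powRr1 ?ltW // powR12_sqrt ?ltW.
have sM : Num.sqrt (v k) <= Num.sqrt M * Num.sqrt k%:R.
  rewrite -sqrtrM; last by apply: le_trans (vM k); rewrite divr_ge0 // ltW.
  by rewrite ler_wsqrtr // -ler_pdivrMr.
have sk0 : 0 < Num.sqrt k%:R :> R by rewrite sqrtr_gt0.
have skk : Num.sqrt k%:R * Num.sqrt k%:R = k%:R :> R.
  by rewrite -expr2 sqr_sqrtr // ltW.
have svv : Num.sqrt (v k) * Num.sqrt (v k) = v k by rewrite -expr2 sqr_sqrtr.
apply: (@le_trans _ _ (2 * (v k / k%:R ^+ 2))).
  rewrite -mulrA ler_wpM2l // mulrC ler_wpM2l // lef_pV2 ?posrE ?exprn_gt0 ?mulr_gt0 //.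
  by rewrite -natrX -natrM ler_nat; nia.
rewrite -mulrA ler_wpM2l // ler_pdivrMr ?exprn_gt0 //.
have -> : Num.sqrt M * (Num.sqrt (v k) / (k%:R * Num.sqrt k%:R)) * k%:R ^+ 2 =
    (Num.sqrt M * Num.sqrt k%:R) * Num.sqrt (v k).
  have key (a b l t : R) : t != 0 -> t * t = l -> a * (b / (l * t)) * l ^+ 2 = a * t * b.
    by move=> t0 <-; field.
  by apply: key => //; rewrite gt_eqF.
by rewrite -{1}svv ler_wpM2r ?sqrtr_ge0.
Qed.

Lemma nneseries_psum_bounded u : (forall k, (0 < k)%N -> 0 <= u k) ->
  (\sum_(1 <= k <oo) (u k)%:E < +oo)%E ->
  exists C, forall n, \sum_(1 <= k < n) u k <= C.
Proof.
move=> u0 fin.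
have u0E : forall k, (1 <= k)%N -> true -> (0 <= (u k)%:E)%E.
  by move=> k k1 _; rewrite lee_fin u0.
exists (fine (\sum_(1 <= k <oo) (u k)%:E)%E) => n.
have fin' : (\sum_(1 <= k <oo) (u k)%:E)%E \is a fin_num.
  by rewrite ge0_fin_numE //; exact: nneseries_ge0.
rewrite -lee_fin fineK // -sumEFin; exact: nneseries_lim_ge.
Qed.

Lemma nneseries_psum_lim u : cvgn (fun n => \sum_(1 <= k < n) u k) ->
  (\sum_(1 <= k <oo) (u k)%:E)%E = (limn (fun n => \sum_(1 <= k < n) u k))%:E.
Proof.
move=> cu; rewrite -EFin_lim //; congr (limn _); apply/funext => n /=.
by rewrite sumEFin.
Qed.

End Analysis.

(** * The limiting variance *)

Section Limit.
Context {R : realType}.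

Lemma cvg_quicksort_ratio (x y : nat -> R) (s : R) : x 0%N = 0 ->
  (forall n, x n.+1 = 2 / n.+1%:R * (\sum_(i < n.+1) x i) + y n.+1) ->
  toll_sum y @ \oo --> s -> y n / n%:R @[n --> \oo] --> (0 : R) ->
  x n / n%:R @[n --> \oo] --> s.
Proof.
move=> x0 xS ys y0; rewrite -cvg_shiftS.
have -> : s = s * (1 + 0) + 0 by ring.
have -> : [sequence x n.+1 / n.+1%:R]_n =
    (fun n => toll_sum y n.+1 * (1 + harmonic n) + y n.+1 / n.+1%:R).
  apply/funext => n /=; rewrite (quicksort_solution x0 xS) /harmonic /=.
  by field; rewrite nat1r pnatr_eq0.
apply: cvgD; last by move: y0; rewrite -cvg_shiftS.
apply: cvgM; first by move: ys; rewrite -cvg_shiftS.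
by apply: cvgD; [exact: cvg_cst | exact: cvg_harmonic].
Qed.

Variables (f : bintree -> R) (g : nat -> nat -> nat -> R).
Hypothesis Hsizes : forall l r : bintree,
  f (Bt_node l r) = g (bt_size (Bt_node l r)) (bt_size l) (bt_size r).

Local Notation F := (additive_functional f).
Local Notation psi := (psiF f g).

Lemma psiF_ge0 (k : nat) : 0 <= psi k. Proof. exact: unif_var_ge0. Qed.

Lemma bst_var_ge0 (h : bintree -> R) (n : nat) : 0 <= bst_var n h.
Proof. exact: unif_var_ge0. Qed.

(** The recurrence expresses each variance as a combination of the psi_k with
nonnegative coefficients and with coefficient 1 for the last of them. *)
Lemma bst_var_psi_eq0 :
  (forall n, (1 <= n)%N -> bst_var n F = 0) <-> (forall n, (1 <= n)%N -> psi n = 0).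
Proof.
split=> [V0 [//|n] _ | psi0 [//|n] _].
  apply/le_anti; rewrite psiF_ge0 andbT -(V0 n.+1) // (bst_var_rec Hsizes) lerDr.
  by rewrite mulr_ge0 // sumr_ge0 // => i _; exact: bst_var_ge0.
have /= -> := quicksort_solution (x := fun n => bst_var n F) (bst_var0 F)
  (bst_var_rec Hsizes) n.
rewrite psi0 // addr0.
rewrite /toll_sum big_nat_cond big1 ?mulr0 // => k /andP[/andP[k0 _] _].
by rewrite psi0 // mulr0.
Qed.

(** If psi_n = 0 then nu_i + nu_(n-1-i) + g takes only its mean value nu_n, so
a = nu works.  Conversely, by induction on the tree, a coboundary toll gives
F(T) = a_|T| - (|T|+1) a_0, because a tree with |T| nodes has |T| + 1 empty
subtrees. *)
Lemma deterministic_iff_coboundary :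
  (forall n, (1 <= n)%N -> bst_var n F = 0) <->
  exists a : nat -> R, forall n k : nat, (1 <= n)%N -> (k <= n - 1)%N ->
    g n k (n - 1 - k)%N = a n - a k - a (n - 1 - k)%N.
Proof.
split=> [/bst_var_psi_eq0 psi0 | [a ga]].
  exists (nuF f) => -[//|n] k _; rewrite subn1 /= => kn.
  have kn' : (k < n.+1)%N by [].
  have := unif_var_eq0 (psi0 n.+1 isT) (Ordinal kn').
  rewrite -(nuF_root_split Hsizes) /root_split subn1 /= => <-; ring.
have Fa T : F T = a (bt_size T) - (bt_size T).+1%:R * a 0%N.
  elim: T => [|l IHl r IHr].
    by rewrite /additive_functional big_nil mul1r subrr.
  rewrite additive_functional_node Hsizes /= IHl IHr.
  have := ga (bt_size l + bt_size r).+1 (bt_size l) isT.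
  rewrite subn1 /= addKn leq_addr => ->//.
  by ring.
move=> n _; rewrite -[LHS]/(bst_expect n (fun T => (F T - bst_expect n F) ^+ 2)).
have E m : bst_expect m F = a m - m.+1%:R * a 0%N.
  by rewrite -[RHS](bst_expect_cst m); apply: eq_bst_expect => T sT; rewrite Fa sT.
rewrite -[RHS](bst_expect_cst n); apply: eq_bst_expect => T sT.
by rewrite E Fa sT subrr expr0n.
Qed.

Hypotheses
  (Hsd : (\sum_(1 <= k <oo)
            (Num.sqrt (bst_var k f) / k%:R `^ (3 / 2))%:E < +oo)%E)
  (Hvar : bst_var k f / k%:R @[k --> \oo] --> (0 : R))
  (Hmean : (\sum_(1 <= k <oo)
              (bst_expect k f ^+ 2 / k%:R ^+ 2)%:E < +oo)%E).

Lemma psiF_summable_and_small :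
  cvgn (toll_sum psi) /\ psi n / n%:R @[n --> \oo] --> (0 : R).
Proof.
have [B yB] : exists B, forall n,
    \sum_(1 <= k < n) bst_expect k f ^+ 2 / k%:R ^+ 2 <= B.
  by apply: nneseries_psum_bounded Hmean => k _; rewrite divr_ge0 ?sqr_ge0.
have [C vC] : exists C, forall n,
    \sum_(1 <= k < n) Num.sqrt (bst_var k f) / k%:R `^ (3 / 2) <= C.
  apply: nneseries_psum_bounded Hsd => k _.
  by rewrite divr_ge0 ?sqrtr_ge0 ?powR_ge0.
have [M vM] : exists M, forall k, bst_var k f / k%:R <= M.
  have /cvg_seq_bounded/bounded_fun_has_ubound[M ubM] :
    cvgn (fun k => bst_var k f / k%:R : R^o) by apply/cvg_ex; exists 0.
  by exists M => k; apply: ubM; exists k.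
pose c := limn (toll_sum (fun k => bst_expect k f)).
pose eta2 i := (nuF f i - i.+1%:R * c) ^+ 2.
have eta2_ge0 k : 0 <= eta2 k by exact: sqr_ge0.
have eta2B := quicksort_mean_fluctuation yB (nuF0 f) (nuFS Hsizes).
have psiB k : (0 < k)%N ->
    psi k <= 3 * bst_var k f + 6 * (k%:R^-1 * \sum_(i < k) eta2 i).
  by case: k => // k _; rewrite mulrA; exact: psiF_le.
split.
  apply: (@psum_is_cvg _ _ (3 * (2 * Num.sqrt M * C) + 6 * (eta2 0%N + 514 * B))).
    by move=> k _; rewrite mulr_ge0 ?psiF_ge0 // divr_ge0 ?mulr_ge0.
  move=> n.
  apply: (@le_trans _ _ (3 * toll_sum (fun k => bst_var k f) n +
    6 * toll_sum (fun k => k%:R^-1 * \sum_(i < k) eta2 i) n)); last first.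
    apply: lerD; rewrite ler_wpM2l //.
      exact: (toll_sum_var_le (bst_var_ge0 f) vC vM).
    exact: (toll_sum_average_le eta2_ge0 eta2B).
  rewrite /toll_sum !mulr_sumr -big_split /=; apply: ler_psum => k k0.
  have distr (t a b : R) : 3 * (t * a) + 6 * (t * b) = t * (3 * a + 6 * b) by ring.
  by rewrite distr ler_wpM2l ?psiB // divr_ge0 ?mulr_ge0.
have upper : 3 * (bst_var n f / n%:R) + 6 * ((\sum_(i < n) eta2 i) / n%:R ^+ 2)
    @[n --> \oo] --> (3 * 0 + 6 * 0 : R).
  by apply: cvgD; apply: cvgM; [exact: cvg_cst | exact: Hvar | exact: cvg_cst |
    exact: (kronecker eta2_ge0 eta2B)].
rewrite !mulr0 addr0 in upper.
apply: (squeeze_cvgr _ (cvg_cst 0) upper).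
near=> n; have n0 : (0 < n)%N by near: n; exact: nbhs_infty_gt.
rewrite divr_ge0 ?psiF_ge0 //= ler_pdivrMr ?ltr0n //.
apply: (le_trans (psiB n n0)).
rewrite le_eqVlt; apply/orP; left; apply/eqP.
by field; rewrite pnatr_eq0 -lt0n.
Unshelve. all: by end_near. Qed.

End Limit.
Theorem theorem1p29 (R : realType) (f : bintree -> R)
  (g : nat -> nat -> nat -> R)
  (Hsd : (\sum_(1 <= k <oo)
            (Num.sqrt (bst_var k f) / k%:R `^ (3 / 2))%:E < +oo)%E)
  (Hvar : bst_var k f / k%:R @[k --> \oo] --> (0 : R))
  (Hmean : (\sum_(1 <= k <oo)
              (bst_expect k f ^+ 2 / k%:R ^+ 2)%:E < +oo)%E)
  (Hsizes : forall l r : bintree,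
     f (Bt_node l r) = g (bt_size (Bt_node l r)) (bt_size l) (bt_size r)) :
  let F := additive_functional f in
  [/\ (forall k : nat, (1 <= k)%N ->
        psiF f g k =
        unif_expect (fun i : 'I_k => (root_split f g i - nuF f k) ^+ 2)),
      cvgn (fun n : nat => bst_var n F / n%:R),
      ((sigma2F f)%:E =
         \sum_(1 <= k <oo) (2 / (k.+1%:R * k.+2%:R) * psiF f g k)%:E)%E /\
      (\sum_(1 <= k <oo)
         (2 / (k.+1%:R * k.+2%:R) * psiF f g k)%:E < +oo)%E,
      (~ (forall n : nat, (1 <= n)%N -> bst_var n F = 0) ->
         0 < sigma2F f)
    & ((forall n : nat, (1 <= n)%N -> bst_var n F = 0) <->
       exists a : nat -> R, forall n k : nat, (1 <= n)%N -> (k <= n - 1)%N ->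
         g n k (n - 1 - k)%N = a n - a k - a (n - 1 - k)%N)].
Proof.
move=> F; have [cS small] := psiF_summable_and_small Hsizes Hsd Hvar Hmean.
have Vlim : bst_var n F / n%:R @[n --> \oo] --> limn (toll_sum (psiF f g)).
  exact: (cvg_quicksort_ratio (x := fun n => bst_var n F) (bst_var0 F)
    (bst_var_rec Hsizes) cS small).
have sigmaE : sigma2F f = limn (toll_sum (psiF f g)) by exact: cvg_lim Vlim.
have seriesE := nneseries_psum_lim cS.
split.
- by move=> [//|k] _; rewrite /psiF /unif_var -(nuF_root_split Hsizes).
- by apply/cvg_ex; exists (limn (toll_sum (psiF f g))).
- by rewrite seriesE sigmaE ltry.
- move=> nV; rewrite sigmaE.
  have term_ge0 k : (0 < k)%N -> 0 <= 2 / (k.+1%:R * k.+2%:R) * psiF f g k.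
    by move=> _; rewrite mulr_ge0 ?psiF_ge0 // divr_ge0 ?mulr_ge0.
  have [k k0 psik] : exists2 k, (1 <= k)%N & psiF f g k != 0.
    apply: contra_notP nV => npsi; apply/(bst_var_psi_eq0 Hsizes) => k k1.
    by apply: contra_notP npsi => /eqP; exists k.
  apply: lt_le_trans (nondecreasing_cvgn_le (psum_nondecreasing term_ge0) cS k.+1).
  rewrite big_nat_recr //= ltr_wpDl //.
    by rewrite big_nat_cond sumr_ge0 // => i /andP[/andP[i0 _] _]; exact: term_ge0.
  have psi_gt0 : 0 < psiF f g k by rewrite lt_def psik psiF_ge0.
  by rewrite mulr_gt0 // divr_gt0 // mulr_gt0.
- exact: deterministic_iff_coboundary Hsizes.
Qed.
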